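(* Let $\mathcal G$ be a finite groupoid and let $\alpha\in Z^1(\mathcal G,U(1))$. Then the dimension of the space of flat sections of the flat line bundle $\alpha_{\mathbb C}$ is given by integrating the transgression $\tau(\alpha)\in Z^0(\Lambda\mathcal G,U(1))$ over the loop groupoid: $$\dim\Gamma_{\mathcal G}(\alpha_{\mathbb C})=\int_{\Lambda\mathcal G}\tau(\alpha).$$
   Context: A finite groupoid is a category with finitely many objects and morphisms, all invertible. A one-cocycle $\alpha\in Z^1(\mathcal G,U(1))$ is a function from morphisms of $\mathcal G$ to $U(1)$ with $\alpha(g_2\circ g_1)=\alpha(g_2)\alpha(g_1)$ for composable $g_2,g_1$ (i.e. a functor to the one-object groupoid with morphism group $U(1)$). Flat sections. $\Gamma_{\mathcal G}(\alpha_{\mathbb C})$ is the complex vector space of maps $s\colon\mathrm{Ob}(\mathcal G)\to\mathbb C$ such that $\alpha(f)s(x_1)=s(x_2)$ for every morphism $f\colon x_1\to x_2$ in $\mathcal G$. Loop groupoid. $\Lambda\mathcal G$ has as objects all self-morphisms $\gamma\in\mathrm{Mor}_{\mathcal G}(x,x)$, $x\in\mathrm{Ob}(\mathcal G)$, and a morphism $g\colon\gamma\to g\gamma g^{-1}$ for each $\gamma\in\mathrm{Mor}_{\mathcal G}(x,x)$ and $g\in\mathrm{Mor}_{\mathcal G}(x,y)$, with composition induced from $\mathcal G$. Transgression. $\tau(\alpha)$ is the locally constant function on $\mathrm{Ob}(\Lambda\mathcal G)$ given by $\tau(\alpha)(\gamma):=\alpha(\gamma)$. Integral. $Z^0(\mathcal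 H,U(1))$ is the set of $U(1)$-valued functions on objects of a finite groupoid $\mathcal H$ constant on connected components. For such a function $\beta$, $\int_{\mathcal H}\beta:=\sum_{x\in\mathrm{Ob}(\mathcal H)}\beta(x)/|x\to|$, where $|x\to|$ is the number of morphisms of $\mathcal H$ with source $x$. *)

(* Defs.v *)
From HB Require Import structures.
From mathcomp Require Import all_boot all_order all_algebra.
From mathcomp Require Import reals complex.

Set Implicit Arguments.
Unset Strict Implicit.
Unset Printing Implicit Defensive.

Import GRing.Theory Num.Theory.
Local Open Scope ring_scope.
Local Open Scope complex_scope.

(* compm g f is g after f, i.e. g \circ f. *)
Record finGroupoid := FinGroupoid {
  Ob : finType;
  Mor : Ob -> Ob -> finType;
  idm : forall x, Mor x x;
  compm : forall x y z, Mor y z -> Mor x y -> Mor x z;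
  invm : forall x y, Mor x y -> Mor y x;
  compA : forall x y z w (h : Mor z w) (g : Mor y z) (f : Mor x y),
    compm h (compm g f) = compm (compm h g) f;
  comp1m : forall x y (f : Mor x y), compm (idm y) f = f;
  compm1 : forall x y (f : Mor x y), compm f (idm x) = f;
  compVm : forall x y (f : Mor x y), compm (invm f) f = idm x;
  compmV : forall x y (f : Mor x y), compm f (invm f) = idm y
}.

Arguments Mor {_} _ _.
Arguments idm {_} x.
Arguments compm {_ x y z} _ _.
Arguments invm {_ x y} _.

Definition conjm (G : finGroupoid) (x y : Ob G) (g : Mor x y) (c : Mor x x) :
  Mor y y := compm (compm g c) (invm g).

Section LoopGroupoid.
Variable G : finGroupoid.

Lemma invm_uniq (x y : Ob G) (f : Mor x y) (h : Mor y x) :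
  compm h f = idm x -> invm f = h.
Proof. by move=> hf; rewrite -[invm f]comp1m -hf -compA compmV compm1. Qed.

Lemma invmM (x y z : Ob G) (g : Mor y z) (f : Mor x y) :
  invm (compm g f) = compm (invm f) (invm g).
Proof.
by apply: invm_uniq; rewrite compA -(compA (invm f)) compVm compm1 compVm.
Qed.

Lemma conjm1 (x : Ob G) (c : Mor x x) : conjm (idm x) c == c.
Proof.
by rewrite /conjm comp1m (invm_uniq (comp1m (idm x))) compm1.
Qed.

Lemma conjmM (x y z : Ob G) (g : Mor y z) (f : Mor x y) (c : Mor x x) :
  conjm (compm g f) c = conjm g (conjm f c).
Proof. by rewrite /conjm invmM !compA. Qed.

Lemma conjmK (x y : Ob G) (f : Mor x y) (c : Mor x x) :
  conjm (invm f) (conjm f c) = c.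
Proof. by rewrite -conjmM compVm (eqP (conjm1 c)). Qed.

Definition loop_ob : finType := {x : Ob G & Mor x x}.

Definition loop_mor (c d : loop_ob) : finType :=
  {g : Mor (tag c) (tag d) | conjm g (tagged c) == tagged d}.

Definition loop_id (c : loop_ob) : loop_mor c c :=
  exist _ (idm (tag c)) (conjm1 (tagged c)).

Lemma loop_comp_subproof (c d e : loop_ob)
    (g : loop_mor d e) (f : loop_mor c d) :
  conjm (compm (val g) (val f)) (tagged c) == tagged e.
Proof. by rewrite conjmM (eqP (valP f)) (eqP (valP g)). Qed.

Definition loop_comp (c d e : loop_ob)
    (g : loop_mor d e) (f : loop_mor c d) : loop_mor c e :=
  exist _ (compm (val g) (val f)) (loop_comp_subproof g f).

Lemma loop_inv_subproof (c d : loop_ob) (f : loop_mor c d) :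
  conjm (invm (val f)) (tagged d) == tagged c.
Proof. by case: f => g /= /eqP <-; rewrite conjmK. Qed.

Definition loop_inv (c d : loop_ob) (f : loop_mor c d) : loop_mor d c :=
  exist _ (invm (val f)) (loop_inv_subproof f).

Definition loop_groupoid : finGroupoid.
Proof.
apply: (@FinGroupoid loop_ob loop_mor loop_id loop_comp loop_inv).
- by move=> *; apply: val_inj; rewrite /= compA.
- by move=> *; apply: val_inj; rewrite /= comp1m.
- by move=> *; apply: val_inj; rewrite /= compm1.
- by move=> *; apply: val_inj; rewrite /= compVm.
- by move=> *; apply: val_inj; rewrite /= compmV.
Defined.

End LoopGroupoid.

(* U(1) is the set of z : R[i] with `|z| = 1. Since alpha(1)^2 = alpha(1) and
   alpha(1) <> 0, Z1M implies that identities go to 1: see Z1_id. *)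
Record Z1 (R : realType) (G : finGroupoid) := MkZ1 {
  Z1_val : forall x y : Ob G, Mor x y -> R[i];
  Z1_norm : forall (x y : Ob G) (f : Mor x y), `|Z1_val f| = 1;
  Z1M : forall (x y z : Ob G) (g : Mor y z) (f : Mor x y),
    Z1_val (compm g f) = Z1_val g * Z1_val f
}.

(* Two objects of a groupoid lie in the same connected component iff there is
   a morphism between them. *)
Record Z0 (R : realType) (H : finGroupoid) := MkZ0 {
  Z0_val :> Ob H -> R[i];
  Z0_norm : forall x : Ob H, `|Z0_val x| = 1;
  Z0_const : forall x y : Ob H, Mor x y -> Z0_val x = Z0_val y
}.

Section Transgression.
Variables (R : realType) (G : finGroupoid) (alpha : Z1 R G).

Lemma Z1_id (x : Ob G) : Z1_val alpha (idm x) = 1.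
Proof.
have a0 : Z1_val alpha (idm x) != 0 by rewrite -normr_eq0 Z1_norm oner_eq0.
by apply: (mulfI a0); rewrite -Z1M comp1m mulr1.
Qed.

Lemma transgression_const (c d : Ob (loop_groupoid G)) :
  Mor c d -> Z1_val alpha (tagged c) = Z1_val alpha (tagged d).
Proof.
by case=> g /eqP/= <-; rewrite !Z1M mulrAC -Z1M compmV Z1_id mul1r.
Qed.

Definition transgression : Z0 R (loop_groupoid G) :=
  @MkZ0 R (loop_groupoid G) (fun c => Z1_val alpha (tagged c))
    (fun c => Z1_norm alpha (tagged c)) transgression_const.

End Transgression.

(* {y : Ob H & Mor x y} is the set of all morphisms with source x. *)
Definition groupoid_integral (R : realType) (H : finGroupoid) (beta : Z0 R H)
    : R[i] :=
  \sum_(x : Ob H) beta x / #|{: {y : Ob H & Mor x y}}|%:R.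

Section FlatSections.
Variables (R : realType) (G : finGroupoid) (alpha : Z1 R G).

Notation sectionT := {ffun Ob G -> R[i]^o}.

Definition is_flat (s : sectionT) : Prop :=
  forall (x1 x2 : Ob G) (f : Mor x1 x2), Z1_val alpha f * s x1 = s x2.

(* flat_sections is cut out as the intersection of the kernels of the linear
   forms flat_defect f; flat_sectionsP identifies its elements. *)
Definition flat_defect (x y : Ob G) (f : Mor x y) (s : sectionT) : R[i]^o :=
  Z1_val alpha f * s x - s y.

Lemma flat_defect_linear (x y : Ob G) (f : Mor x y) :
  linear (flat_defect f).
Proof.
move=> a u v; rewrite /flat_defect.
have E z : (a *: u + v) z = a * u z + v z :> R[i] by rewrite !ffunE.
have -> : a *: (Z1_val alpha f * u x - u y : R[i]^o)
  = a * (Z1_val alpha f * u x - u y) :> R[i] by [].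
by rewrite !E mulrBr mulrDr mulrCA opprD addrACA.
Qed.

HB.instance Definition _ (x y : Ob G) (f : Mor x y) :=
  GRing.isLinear.Build R[i] sectionT R[i]^o _ (flat_defect f)
    (flat_defect_linear f).

Definition flat_sections : {vspace sectionT} :=
  (\bigcap_(x : Ob G) \bigcap_(y : Ob G) \bigcap_(f : Mor x y)
     lker (linfun (flat_defect f)))%VS.

Lemma flat_sectionsP (s : sectionT) : s \in flat_sections <-> is_flat s.
Proof.
rewrite memvE; split.
  move=> /subv_bigcapP sV x y f.
  move: (sV x isT) => /subv_bigcapP/(_ y isT)/subv_bigcapP/(_ f isT).
  by rewrite -memvE memv_ker lfunE /= subr_eq0 => /eqP.
move=> sF; apply/subv_bigcapP=> x _; apply/subv_bigcapP=> y _.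
apply/subv_bigcapP=> f _; rewrite -memvE memv_ker lfunE /= subr_eq0.
exact/eqP.
Qed.

End FlatSections.

(* Main.v *)
(** Averaging a section over all morphisms into a point, [(P s) y] being the
    mean of [alpha f * s x] over all [f : x -> y], projects onto the flat
    sections, so the dimension is the trace of [P].  Its diagonal entry at [x]
    is the sum of [alpha c] over the loops [c] at [x], divided by the number of
    morphisms out of [x]; and in the loop groupoid exactly as many morphisms
    start at [c]. *)
From HB Require Import structures.
Require Import Defs.
From mathcomp Require Import all_boot all_order all_algebra.
From mathcomp Require Import reals complex.
Local Open Scope ring_scope.
Local Open Scope complex_scope.
Import GRing.Theory Num.Theory.

Set Implicit Arguments.
Unset Strict Implicit.
Unset Printing Implicit Defensive.

Section ProjectionTrace.
Variables (F : fieldType) (T : finType).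

Definition ffun_delta (x : T) : {ffun T -> F^o} := [ffun y => (y == x)%:R].

Lemma ffun_sum_delta (s : {ffun T -> F^o}) : s = \sum_x s x *: ffun_delta x.
Proof.
apply/ffunP=> y; rewrite sum_ffunE (bigD1 y) //= big1 => [|x xy].
  by rewrite !ffunE eqxx addr0 [RHS]mulr1.
by rewrite !ffunE eq_sym (negPf xy) [LHS]mulr0.
Qed.

(** Expand each [P (ffun_delta x)] in the basis [X] of [V] and exchange the sums. By linearity the
    i-th basis vector then contributes its own coordinate in its image under [P], which is 1 because
    [P] fixes [V]. *)
Lemma dim_projection_trace (V : {vspace {ffun T -> F^o}})
    (P : {linear {ffun T -> F^o} -> {ffun T -> F^o}}) :
  (forall s, P s \in V) -> (forall s, s \in V -> P s = s) ->
  (\dim V)%:R = \sum_x P (ffun_delta x) x.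
Proof.
move=> PV Pid; set X := vbasis V.
have coordX i : coord X i (P X`_i) = 1.
  by rewrite Pid ?vbasis_mem ?mem_nth ?size_tuple // coord_free
             ?eqxx ?(basis_free (vbasisP V)).
have E x : P (ffun_delta x) x = \sum_i coord X i (P (ffun_delta x)) * X`_i x.
  rewrite {1}(coord_vbasis (PV _)) sum_ffunE.
  by apply: eq_bigr => i _; rewrite ffunE.
rewrite (eq_bigr _ (fun x _ => E x)) exchange_big /=.
rewrite -[\dim V in LHS]card_ord -sumr_const; apply: eq_bigr => i _.
(* The summand 1 is read backwards through [coordX], and the basis vector inside [P] is split into
   deltas to match the sum over [x]. *)
rewrite -(coordX i) {1}(ffun_sum_delta X`_i) !linear_sum.
by apply: eq_bigr => x _; rewrite !linearZ [LHS]mulrC.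
Qed.

End ProjectionTrace.

Section Groupoid.
Variable G : finGroupoid.

Lemma compm_bij (w x y : Ob G) (g : Mor x y) :
  bijective (fun f : Mor w x => compm g f).
Proof.
exists (fun f => compm (invm g) f) => f;
by rewrite Defs.compA ?compVm ?compmV comp1m.
Qed.

Lemma invmK (x y : Ob G) (f : Mor x y) : invm (invm f) = f.
Proof. by apply: invm_uniq; rewrite compmV. Qed.

(** Counting by target suits [average], which sums over morphisms into a point; inversion later
    converts this to the count by source in the integral. *)
Definition indegree (y : Ob G) : nat := \sum_(x : Ob G) #|Mor x y|.

Lemma indegree_gt0 (y : Ob G) : (0 < indegree y)%N.
Proof.
rewrite /indegree (bigD1 y) //= addn_gt0; apply/orP; left.
by apply/card_gt0P; exists (idm y).
Qed.

Lemma eq_indegree (x y : Ob G) (g : Mor x y) : indegree x = indegree y.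
Proof. by apply: eq_bigr => w _; apply: (bij_eq_card (compm_bij w g)). Qed.

Lemma card_Mor_from (x : Ob G) : #|{: {y : Ob G & Mor x y}}| = indegree x.
Proof.
rewrite card_tagged sumnE big_map big_enum; apply: eq_bigr => y _.
by apply: (@bij_eq_card _ _ invm); exists invm => f; rewrite invmK.
Qed.

(** Every [g] out of the base point of [c] is allowed: the conjugation condition merely forces the
    target loop to be [conjm g (tagged c)]. *)
Lemma card_loop_Mor_from (c : Ob (loop_groupoid G)) :
  #|{: {d : Ob (loop_groupoid G) & Mor c d}}|
  = #|{: {y : Ob G & Mor (tag c) y}}|.
Proof.
pose ends (u : {y : Ob G & Mor (tag c) y}) : Ob (loop_groupoid G) :=
  Tagged (fun y : Ob G => Mor y y) (conjm (tagged u) (tagged c)).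
pose to (u : {d : Ob (loop_groupoid G) & Mor c d}) :
    {y : Ob G & Mor (tag c) y} :=
  Tagged (fun y : Ob G => Mor (tag c) y) (val (tagged u)).
pose of_ (u : {y : Ob G & Mor (tag c) y}) :
    {d : Ob (loop_groupoid G) & Mor c d} :=
  existT (fun d : Ob (loop_groupoid G) => Mor c d) (ends u)
    (exist _ (tagged u) (eqxx _)).
apply: (@bij_eq_card _ _ to); exists of_; last by case.
(* With the target loop replaced by the conjugate, both sides differ only in the proof of the
   conjugation condition. *)
case=> -[y d] [] /= g gP; have /= dE := eqP gP; subst d.
by congr existT; apply: val_inj.
Qed.

End Groupoid.

Section Averaging.
Variables (R : realType) (G : finGroupoid) (alpha : Z1 R G).

Notation sectionT := {ffun Ob G -> R[i]^o}.

Definition average (s : sectionT) : sectionT :=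
  [ffun y => (indegree y)%:R^-1
             * \sum_(x : Ob G) \sum_(f : Mor x y) Z1_val alpha f * s x].

Lemma average_linear : linear average.
Proof.
move=> a u v; apply/ffunP => y; rewrite !ffunE.
rewrite [X in _ = X + _]mulrCA -mulrDr; congr (_ * _).
rewrite mulr_sumr -big_split; apply: eq_bigr => x _ /=.
rewrite mulr_sumr -big_split; apply: eq_bigr => f _ /=.
by rewrite !ffunE mulrDr [in LHS]mulrCA.
Qed.

HB.instance Definition _ :=
  GRing.isLinear.Build R[i] sectionT sectionT _ average average_linear.

(** Post-composition with [g : y -> z] matches the morphisms into [y] with those into [z], and by
    [Z1M] scales each term by the value of [alpha] at [g]; the normalizing factors agree by
    [eq_indegree]. *)
Lemma average_flat (s : sectionT) : average s \in flat_sections alpha.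
Proof.
apply/flat_sectionsP => y z g; rewrite !ffunE (eq_indegree g) mulrCA.
congr (_ * _); rewrite mulr_sumr; apply: eq_bigr => x _.
rewrite mulr_sumr [RHS](reindex _ (onW_bij _ (compm_bij x g))).
by apply: eq_bigr => f _; rewrite Z1M mulrA.
Qed.

Lemma average_id (s : sectionT) : s \in flat_sections alpha -> average s = s.
Proof.
move=> /flat_sectionsP sF; apply/ffunP => y; rewrite ffunE.
have -> : \sum_(x : Ob G) \sum_(f : Mor x y) Z1_val alpha f * s x
          = (indegree y)%:R * s y.
  rewrite natr_sum mulr_suml; apply: eq_bigr => x _.
  by rewrite (eq_bigr _ (fun f _ => sF _ _ f)) sumr_const mulr_natl.
(* The division is sound: identities make [indegree y] positive, and [R[i]] has characteristic
   zero. *)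
by rewrite mulKf // pnatr_eq0 -lt0n indegree_gt0.
Qed.

Lemma average_diagonal (x : Ob G) :
  average (ffun_delta _ x) x
  = (indegree x)%:R^-1 * \sum_(c : Mor x x) Z1_val alpha c.
Proof.
rewrite ffunE (bigD1 x) //= [X in _ + X]big1 => [|w wx].
  rewrite addr0; congr (_ * _).
  by apply: eq_bigr => c _; rewrite ffunE eqxx mulr1.
by apply: big1 => f _; rewrite ffunE (negPf wx) mulr0.
Qed.

End Averaging.

Theorem theorem6 (R : realType) (G : finGroupoid) (alpha : Z1 R G) :
  (\dim (flat_sections alpha))%:R = groupoid_integral (transgression alpha).
Proof.
rewrite (dim_projection_trace (average_flat alpha) (@average_id _ _ alpha)).
rewrite /groupoid_integral.
under [RHS]eq_bigr => c _ do rewrite card_loop_Mor_from card_Mor_from.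
transitivity (\sum_x \sum_(c : Mor x x) Z1_val alpha c / (indegree x)%:R).
  by apply: eq_bigr => x _; rewrite average_diagonal mulrC mulr_suml.
(* Objects of the loop groupoid are pairs of a point and a loop at it, so the double sum is a single
   sum over them. *)
exact: (sig_big_dep _ (fun _ => xpredT)
  (fun x (c : Mor x x) => Z1_val alpha c / (indegree x)%:R)).
Qed.
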